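(* Let $\lambda>0$. There exists $b_0\in{\rm BMO}_{\triangle_\lambda}(\mathbb R_+)$ such that $[b_0,R_\lambda]$ is not of weak type $(1,1)$ on $(\mathbb R_+,\mu)$, i.e. there is no constant $C$ with $\mu(\{x\in\mathbb R_+:|[b_0,R_\lambda]f(x)|>t\})\le \frac Ct\|f\|_{L^1(\mathbb R_+,\mu)}$ for all $f$ and all $t>0$.
   Context: On $\mathbb R_+=(0,\infty)$, $d\mu(x)=x^{2\lambda}dx$; intervals are $B=(a,b)\subset\mathbb R_+$. ${\rm BMO}_{\triangle_\lambda}(\mathbb R_+)$: $f\in L^1_{loc}(\mu)$ with $\sup_B\frac1{\mu(B)}\int_B|f-f_B|d\mu<\infty$, $f_B=\frac1{\mu(B)}\int_Bf\,d\mu$. $R_\lambda=\frac{d}{dx}\triangle_\lambda^{-1/2}$ is the Bessel Riesz transform associated with $\triangle_\lambda=-\frac{d^2}{dx^2}-\frac{2\lambda}x\frac d{dx}$: $R_\lambda f(x)=\mathrm{p.v.}\int_0^\infty R_\lambda(x,y)f(y)d\mu(y)$, $R_\lambda(x,y)=-\frac{2\lambda}{\pi}\int_0^\pi\frac{(x-y\cos\theta)(\sin\theta)^{2\lambda-1}}{(x^2+y^2-2xy\cos\theta)^{\lambda+1}}d\theta$; $[b,R_\lambda]f=bR_\lambda f-R_\lambda(bf)$. *)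

(* Defs.v *)
From HB Require Import structures.
From mathcomp Require Import all_boot all_order all_algebra.
From mathcomp Require Import all_classical all_reals all_analysis.
Set Implicit Arguments. Unset Strict Implicit. Unset Printing Implicit Defensive.
Import Order.TTheory GRing.Theory Num.Theory.
Import numFieldNormedType.Exports.
Local Open Scope classical_set_scope.
Local Open Scope ring_scope.

Section BesselDefs.
Variable R : realType.
Variable lam : R.

Definition wmu (x : R) : R := x `^ (2 * lam).

Definition muB (A : set R) : \bar R :=
  (\int[lebesgue_measure]_(x in A) (wmu x)%:E)%E.

Definition L1mu (f : R -> R) : Prop :=
  lebesgue_measure.-integrable `]0, +oo[ (fun x => (f x * wmu x)%:E).

Definition L1norm (f : R -> R) : R :=
  Rintegral lebesgue_measure `]0, +oo[ (fun x => `|f x| * wmu x).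

Definition meanB (f : R -> R) (a b : R) : R :=
  Rintegral lebesgue_measure `]a, b[ (fun x => f x * wmu x) /
  Rintegral lebesgue_measure `]a, b[ wmu.

Definition BMO (f : R -> R) : Prop :=
  (forall a b : R, 0 <= a -> a < b ->
     lebesgue_measure.-integrable `]a, b[ (fun x => (f x * wmu x)%:E)) /\
  exists M : R, forall a b : R, 0 <= a -> a < b ->
     Rintegral lebesgue_measure `]a, b[
       (fun x => `|f x - meanB f a b| * wmu x) /
     Rintegral lebesgue_measure `]a, b[ wmu <= M.

Definition Rkernel (x y : R) : R :=
  - (2 * lam / pi) *
  Rintegral lebesgue_measure `[0, pi]
    (fun th => (x - y * cos th) * (sin th) `^ (2 * lam - 1) /
               (x ^+ 2 + y ^+ 2 - 2 * x * y * cos th) `^ (lam + 1)).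

Definition truncR (f : R -> R) (x eps : R) : R :=
  Rintegral lebesgue_measure [set y | 0 < y /\ eps < `|x - y|]
    (fun y => Rkernel x y * f y * wmu y).

Definition pvR (f : R -> R) (x L : R) : Prop :=
  (\forall eps \near 0^'+,
     lebesgue_measure.-integrable [set y | 0 < y /\ eps < `|x - y|]
       (fun y => (Rkernel x y * f y * wmu y)%:E)) /\
  (truncR f x eps @[eps --> 0^'+] --> L).

(* [b,R_lambda] f (x) = b(x) R_lambda f(x) - R_lambda(b f)(x) is defined
   and |[b,R_lambda] f (x)| > t *)
Definition comm_gt (b f : R -> R) (t x : R) : Prop :=
  exists L1 L2 : R, pvR f x L1 /\ pvR (fun y => b y * f y) x L2 /\
    t < `|b x * L1 - L2|.

End BesselDefs.

(* Main.v *)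
Require Import Defs.
From HB Require Import structures.
From mathcomp Require Import all_boot all_order all_algebra.
From mathcomp Require Import all_classical all_reals all_analysis.
From mathcomp Require Import measurable_realfun ring lra.
Set Implicit Arguments. Unset Strict Implicit. Unset Printing Implicit Defensive.
Import Order.TTheory GRing.Theory Num.Theory.
Import numFieldNormedType.Exports.
Local Open Scope classical_set_scope.
Local Open Scope ring_scope.

(** Take [b0 = ln] and let [f] be the indicator of [(0, e)].  For [0 < y < x]
    the kernel [R_lam(x, y)] is nonsingular and negative, and bounded away from
    [0] for [x] in [(1, 2)] and [y <= 1/2].  Hence, for [x] in [(1, 2)],
      [|[ln, R_lam] f (x)| = int_0^e (ln x - ln y) |R_lam(x, y)| dmu(y)
        >= c ln(1/e) ||f||_1],
    so that a weak type bound would give [mu (1, 2) <= C / (c ln(1/e))] for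
    every small [e], which is absurd.

    That [ln] is in BMO comes from the bound
      [|ln x - ln b| x^(2 lam) <= b^(2 lam) / (2 lam)]   for [0 < x <= b].
    When [lam < 1/2] the kernel is finite only because [sin^(2 lam - 1)] is
    integrable on [[0, pi]]: with [q = 2 lam], the function [q sin^(q - 1)] is
    dominated by the derivative of the bounded function
    [sin^q cos + (q + 1) id]. *)

Lemma powR_le1 (R : realType) (a r : R) : 0 <= a <= 1 -> 0 <= r -> a `^ r <= 1.
Proof.
move=> /andP[a0 a1] r0; have <- : 1 `^ r = 1 by rewrite powR1.
by rewrite ge0_ler_powR ?nnegrE.
Qed.

Lemma ler_div_powR (R : realType) (p u1 u2 v1 v2 : R) : 0 <= p ->
  0 <= u1 <= u2 -> 0 < v2 <= v1 -> u1 / v1 `^ p <= u2 / v2 `^ p.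
Proof.
move=> p0 /andP[u10 u12] /andP[v20 v21]; have v10 := lt_le_trans v20 v21.
rewrite ler_pM ?invr_ge0 ?powR_ge0// lef_pV2 ?posrE ?powR_gt0//.
by rewrite ge0_ler_powR ?nnegrE// ltW.
Qed.

Lemma itvoo_bigcup_itvcc (R : realType) (a b : R) :
  `]a, b[%classic = \bigcup_n `[a + n.+1%:R^-1, b - n.+1%:R^-1]%classic.
Proof.
apply/seteqP; split=> [x|x [n _]] /=; rewrite !in_itv/= => /andP[ax xb].
  pose delta := Num.min (x - a) (b - x).
  have delta0 : 0 < delta by rewrite lt_min !subr_gt0 ax.
  exists (Num.truncn delta^-1) => //=; rewrite in_itv/=.
  have : (Num.truncn delta^-1).+1%:R^-1 <= delta.
    by rewrite invf_ple ?posrE// ltW// truncnS_gt.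
  by rewrite le_min lerBrDl => /andP[-> /=]; rewrite lerBrDr addrC -lerBrDr.
by rewrite (lt_le_trans _ ax) ?(le_lt_trans xb) ?ltrDl ?gtrBl.
Qed.

Section integration.
Context (d : measure_display) (T : measurableType d) (R : realType).
Variable mu : {measure set T -> \bar R}.
Implicit Types (D S : set T) (f : T -> R).

Lemma Rintegral_gt0 D f : measurable D -> mu D != 0%E ->
  mu.-integrable D (EFin \o f) -> (forall x, D x -> 0 < f x) ->
  0 < \int[mu]_(x in D) f x.
Proof.
move=> mD D0 intf f0.
have fge0 x : D x -> 0 <= f x by move/f0/ltW.
rewrite lt_neqAle Rintegral_ge0// andbT eq_sym.
apply: contra D0 => /eqP int0; apply/eqP.
have [N [mN N0 DN]] : ae_eq mu D (EFin \o f) (cst 0%E).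
  apply/ae_eq_integral_abs => //; first exact: measurable_int intf.
  under eq_integral => x /set_mem/fge0 fx do rewrite gee0_abs ?lee_fin//.
  by rewrite -(fineK (integrable_fin_num mD intf)); congr EFin.
apply: (subset_measure0 mD mN _ N0) => x Dx; apply: DN => /= /(_ Dx) -[].
by move/eqP; rewrite gt_eqF// f0.
Qed.

Lemma integrable_bounded_by D f (M : R) : measurable D -> (mu D < +oo)%E ->
  measurable_fun D f -> (forall x, D x -> `|f x| <= M) ->
  mu.-integrable D (EFin \o f).
Proof.
move=> mD Dfin mf fM; apply: measurable_bounded_integrable => //.
exists M; split; first exact: num_real.
by move=> N MN x /fM fxM; exact: le_trans fxM (ltW MN).
Qed.

Section support_sub.
Variables (S D : set T) (f : T -> R).
Hypotheses (mS : measurable S) (mD : measurable D) (SD : S `<=` D).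
Hypothesis f0 : forall x, ~ S x -> f x = 0.

Let restrict_support : f \_ S = f.
Proof.
apply/funext => x; rewrite patchE; case: ifPn => // /negP xS.
by rewrite f0// => /mem_set.
Qed.

Lemma integrable_support_sub :
  mu.-integrable S (EFin \o f) -> mu.-integrable D (EFin \o f).
Proof.
rewrite -{1}(setIidr SD) => /integrable_restrict-/(_ mS mD).
by rewrite restrict_EFin restrict_support.
Qed.

Lemma Rintegral_support_sub : \int[mu]_(x in D) f x = \int[mu]_(x in S) f x.
Proof.
by rewrite -[S in RHS](setIidr SD) Rintegral_mkcondr restrict_support.
Qed.

End support_sub.

End integration.

Lemma measurable_fun_parametric_Rintegral (d1 d2 : measure_display)
    (T1 : measurableType d1) (T2 : measurableType d2) (R : realType)
    (mu : {sigma_finite_measure set T2 -> \bar R}) (D : set T2)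
    (f : T1 * T2 -> R) :
  measurable D -> measurable_fun setT f ->
  measurable_fun setT (fun x => \int[mu]_(y in D) f (x, y)).
Proof.
move=> mD mf.
pose g (z : T1 * T2) := ((EFin \o (fun y => f (z.1, y))) \_ D) z.2.
have mg : measurable_fun setT g.
  rewrite (_ : g = (EFin \o f) \_ (setT `*` D)).
    have mTD : measurable (setT `*` D : set (T1 * T2)) by exact: measurableX.
    apply/(measurable_restrictT _ mTD)/measurable_EFinP.
    exact: measurable_funTS.
  by apply/funext => -[x y]; rewrite /g !patchE/= in_setX in_setT.
have mF : measurable_fun setT (fun x => \int[mu]_y g (x, y))%E.
  rewrite (_ : (fun _ => _) = fubini_F mu g^\+ \- fubini_F mu g^\-)%E; last first.
    apply/funext => x; rewrite integralE.
    by congr (_ - _)%E; apply: eq_integral => y _; rewrite ?funeposE ?funenegE.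
  apply: emeasurable_funB; apply: measurable_fun_fubini_tonelli_F => //.
    exact: measurable_funepos.
  exact: measurable_funeneg.
rewrite /Rintegral; under eq_fun do rewrite integral_mkcond.
exact: measurableT_comp mF.
Qed.

Section weighted_mean.
Context (d : measure_display) (T : measurableType d) (R : realType).
Variables (mu : {measure set T -> \bar R}) (D : set T) (w f : T -> R).
Hypotheses (mD : measurable D) (w_ge0 : forall x, 0 <= w x).
Hypothesis intw : mu.-integrable D (EFin \o w).
Hypothesis intfw : mu.-integrable D (EFin \o (fun x => f x * w x)).
Hypothesis w_gt0 : 0 < \int[mu]_(x in D) w x.

Let mean : R := (\int[mu]_(x in D) (f x * w x)) / \int[mu]_(x in D) w x.

Let intcw k : mu.-integrable D (EFin \o (fun x => k * w x)).
Proof. exact: (integrableZl _ k intw). Qed.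

Let int_subw k : mu.-integrable D (EFin \o (fun x => (f x - k) * w x)).
Proof.
apply: eq_integrable (integrableB mD intfw (intcw k)) => // x _ /=.
by rewrite mulrBl EFinB.
Qed.

Let int_distw k : mu.-integrable D (EFin \o (fun x => `|f x - k| * w x)).
Proof.
apply: eq_integrable (integrable_norm (int_subw k)) => // x _ /=.
by rewrite normrM (ger0_norm (w_ge0 x)).
Qed.

Lemma weighted_mean_dist_le c :
  `|c - mean| * \int[mu]_(x in D) w x <= \int[mu]_(x in D) (`|f x - c| * w x).
Proof.
have -> : `|c - mean| * \int[mu]_(x in D) w x =
    `|\int[mu]_(x in D) ((f x - c) * w x)|.
  under [in RHS]eq_Rintegral do rewrite mulrBl.
  rewrite RintegralB// RintegralZl// -[X in _ * X = _](gtr0_norm w_gt0).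
  by rewrite -normrM mulrBl divfK ?gt_eqF// -opprB normrN.
apply: le_trans (le_normr_Rintegral mD (int_subw c)) _.
by under eq_Rintegral do rewrite normrM (ger0_norm (w_ge0 _)).
Qed.

Lemma weighted_mean_oscillation_le c :
  \int[mu]_(x in D) (`|f x - mean| * w x) <=
  2 * \int[mu]_(x in D) (`|f x - c| * w x).
Proof.
apply: (@le_trans _ _
    (\int[mu]_(x in D) (`|f x - c| * w x + `|c - mean| * w x))).
  apply: le_Rintegral => //.
    by apply: eq_integrable (integrableD mD (int_distw c) (intcw `|c - mean|)).
  by move=> x _; rewrite -mulrDl ler_wpM2r// ler_distD.
rewrite RintegralD// RintegralZl// mulrDl mul1r lerD2l.
exact: weighted_mean_dist_le.
Qed.

End weighted_mean.

Section lebesgue_integration.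
Context {R : realType}.
Local Notation mu := (@lebesgue_measure R).
Implicit Types (f F : R -> R) (a b M : R).

Lemma integrable_itvoo_bounded f a b M : measurable_fun `]a, b[ f ->
  {in `]a, b[, forall x, `|f x| <= M} -> mu.-integrable `]a, b[ (EFin \o f).
Proof.
move=> mf fM; apply: (integrable_bounded_by (M := M)) => //=.
by rewrite lebesgue_measure_itv/=; case: ifPn => // _; rewrite -EFinB ltry.
Qed.

Lemma integral_itvcc_bounded_primitive F f a b M : a < b ->
  {in `[a, b], forall x : R, is_derive x 1 F (f x)} ->
  {in `[a, b], continuous f} ->
  {in `[a, b], forall x, `|F x| <= M} ->
  (\int[mu]_(x in `[a, b]) (f x)%:E <= (2 * M)%:E)%E.
Proof.
move=> ab derF cf FM.
have aab : a \in `[a, b] by rewrite in_itv/= lexx ltW.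
have bab : b \in `[a, b] by rewrite in_itv/= lexx ltW.
have cF x : x \in `[a, b] -> {for x, continuous F}.
  move=> /derF dF; apply/differentiable_continuous/derivable1_diffP.
  exact: ex_derive.
rewrite (@continuous_FTC2 _ f F)//.
- rewrite -EFinB lee_fin mulr2n mulrDl mul1r lerD//.
  + by rewrite (le_trans (ler_norm _))// FM.
  + by rewrite (le_trans (ler_norm _))// normrN FM.
- by apply: continuous_in_subspaceT => x /set_mem; exact: cf.
- split; last 2 first.
  + exact/cvg_at_right_filter/cF.
  + exact/cvg_at_left_filter/cF.
  by move=> x /subset_itv_oo_cc/derF dF; exact: ex_derive.
- by move=> x /subset_itv_oo_cc/derF dF; rewrite derive1E; exact: derive_val.
Qed.

Lemma integrable_ge0_bounded_primitive F f a b M :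
  {in `]a, b[, forall x : R, is_derive x 1 F (f x)} ->
  {in `]a, b[, continuous f} ->
  {in `]a, b[, forall x, 0 <= f x} ->
  {in `]a, b[, forall x, `|F x| <= M} ->
  mu.-integrable `]a, b[ (EFin \o f).
Proof.
move=> derF cf f0 FM.
have mf : measurable_fun `]a, b[ f.
  by apply: open_continuous_measurable_fun => // x /set_mem; exact: cf.
have [ab|ba] := ltP a b; last first.
  by rewrite set_itv_ge -?leNgt//; exact: integrable_set0.
apply/integrableP; split; first exact/measurable_EFinP.
under eq_integral => x /set_mem/f0 fx do rewrite gee0_abs ?lee_fin//.
pose K n : set R := `[a + n.+1%:R^-1, b - n.+1%:R^-1]%classic.
have Ksub n : K n `<=` `]a, b[.
  by rewrite itvoo_bigcup_itvcc => x Kx; exists n.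
have cvgK : (\int[mu]_(x in K n) (f x)%:E @[n --> \oo] -->
    \int[mu]_(x in `]a, b[) (f x)%:E)%E.
  rewrite itvoo_bigcup_itvcc; apply: ge0_nondecreasing_set_cvg_integral => //.
  - move=> n m nm; apply/subsetPset/subset_itv;
      by rewrite bnd_simp lerD2l ?lerN2 lef_pV2 ?posrE// ler_nat.
  - by move=> n; exact: measurable_itv.
  - move=> n; apply/measurable_EFinP; exact: measurable_funS (Ksub n) mf.
  - by move=> n x /Ksub/f0 fx; rewrite lee_fin.
apply: (@le_lt_trans _ _ (2 * M)%:E); last exact: ltry.
rewrite -(cvg_lim _ cvgK)//; apply: lime_le.
  by apply/cvg_ex; eexists; exact: cvgK.
have ab2 : 0 < (b - a) / 2 by lra.
near=> n; apply: integral_itvcc_bounded_primitive => //.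
- have : n.+1%:R^-1 < (b - a) / 2.
    by near: n; exact: (near_infty_natSinv_lt (PosNum ab2)).
  by move: (n.+1%:R^-1) => u; lra.
- by move=> x /Ksub; exact: derF.
- by move=> x /Ksub; exact: cf.
- by move=> x /Ksub; exact: FM.
Unshelve. all: by end_near. Qed.

End lebesgue_integration.

Section sin_powR.
Context {R : realType}.
Local Notation mu := (@lebesgue_measure R).
Implicit Types (q r x : R) (D : set R).

Lemma measurable_sin_powR D r : measurable_fun D (fun x => sin x `^ r).
Proof.
apply: measurable_funTS; apply: (measurableT_comp (measurable_powR r)).
by apply: continuous_measurable_fun; exact: continuous_sin.
Qed.

Lemma is_derive_sin_powR r x : 0 < sin x ->
  is_derive x 1 (fun t => sin t `^ r) (r * sin x `^ (r - 1) * cos x).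
Proof.
move=> sx; apply: (@is_derive1_comp R (@powR R ^~ r) sin x).
exact: is_derive1_powR.
Qed.

Let majorant q x : R :=
  q * sin x `^ (q - 1) + (q + 1) * (1 - sin x `^ (q + 1)).

Let is_derive_majorant_primitive q x : 0 < sin x ->
  is_derive x 1 (fun t => sin t `^ q * cos t + (q + 1) * t) (majorant q x).
Proof.
move=> sx.
have dsc := is_deriveM (is_derive_sin_powR q sx) (is_derive_cos x).
have dq := is_deriveM (is_derive_cst (q + 1) x 1) (is_derive_id x 1).
apply: is_derive_eq (is_deriveD dsc dq) _.
have sinM r : sin x `^ (r + 1) = sin x `^ r * sin x.
  by rewrite powRD ?(gt_eqF sx) ?implybT// powRr1// ltW.
have sinq : sin x `^ q = sin x `^ (q - 1) * sin x by rewrite -sinM subrK.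
rewrite /majorant sinM sinq /GRing.scale/= /cst.
by rewrite mulrCA -expr2 cos2sin2; ring.
Qed.

Let continuous_majorant q x : 0 < sin x -> {for x, continuous (majorant q)}.
Proof.
move=> sx.
have csin r : {for x, continuous (fun t => sin t `^ r)}.
  apply/differentiable_continuous/derivable1_diffP.
  exact: (@ex_derive _ _ _ _ _ _ _ (is_derive_sin_powR r sx)).
apply: cvgD; apply: cvgM; [exact: cvg_cst|exact: csin|exact: cvg_cst|].
by apply: cvgB; [exact: cvg_cst|exact: csin].
Qed.

Let sin_powR_le_majorant q x : 0 < q -> 0 < sin x ->
  q * sin x `^ (q - 1) <= majorant q x.
Proof.
move=> q0 sx; rewrite lerDl mulr_ge0 ?subr_ge0 ?addr_ge0 ?(ltW q0)//.
by rewrite powR_le1 ?sin_le1 ?addr_ge0 ?(ltW sx) ?(ltW q0).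
Qed.

Lemma integrable_sin_powR q : 0 < q ->
  mu.-integrable `[0, pi] (EFin \o (fun x => sin x `^ (q - 1))).
Proof.
move=> q0.
have sin_itv x : x \in `]0, pi[ -> 0 < sin x.
  by rewrite in_itv/=; exact: sin_gt0_pi.
have int_majorant : mu.-integrable `]0, pi[ (EFin \o majorant q).
  apply: (@integrable_ge0_bounded_primitive _
    (fun t => sin t `^ q * cos t + (q + 1) * t) _ _ _ (1 + (q + 1) * pi)).
  - by move=> x /sin_itv; exact: is_derive_majorant_primitive.
  - by move=> x /sin_itv; exact: continuous_majorant.
  - move=> x /sin_itv/(sin_powR_le_majorant q0); apply: le_trans.
    by rewrite mulr_ge0 ?powR_ge0// ltW.
  - move=> x x0pi; have sx := sin_itv x x0pi.
    move: x0pi; rewrite in_itv/= => /andP[x0 xpi].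
    rewrite (le_trans (ler_normD _ _))// lerD// normrM.
      rewrite mulr_ile1 ?cos_max// ger0_norm ?powR_ge0//.
      by rewrite powR_le1 ?sin_le1 ?(ltW sx) ?(ltW q0).
    by rewrite !gtr0_norm ?addr_gt0// ler_pM2l ?addr_gt0// ltW.
have int_oo : mu.-integrable `]0, pi[ (EFin \o (fun x => sin x `^ (q - 1))).
  apply: le_integrable (integrableZl _ q^-1 int_majorant) => //.
    by apply/measurable_EFinP; exact: measurable_sin_powR.
  move=> x /sin_itv sx /=; have := sin_powR_le_majorant q0 sx.
  rewrite lee_fin ger0_norm ?powR_ge0// -ler_pdivlMl// => /le_trans; apply.
  exact: ler_norm.
have msin D : measurable_fun D (EFin \o (fun x => sin x `^ (q - 1))).
  by apply/measurable_EFinP; exact: measurable_sin_powR.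
move/integrableP: int_oo => [_ int_oo]; apply/integrableP.
split; first exact: msin.
by rewrite integral_itv_bndoo//; exact: measurableT_comp.
Qed.

Lemma Rintegral_sin_powR_gt0 q : 0 < q ->
  0 < \int[mu]_(x in `[0, pi]) (sin x `^ (q - 1)).
Proof.
move=> q0.
have int_oo : mu.-integrable `]0, pi[ (EFin \o (fun x : R => sin x `^ (q - 1))).
  by apply: integrableS (integrable_sin_powR q0) => //; exact: subset_itv_oo_cc.
rewrite /Rintegral integral_itv_bndoo; last exact: measurable_int int_oo.
apply: Rintegral_gt0 => //=.
  rewrite lebesgue_measure_itv/= lte_fin pi_gt0 oppr0 adde0 eqe.
  by rewrite gt_eqF ?pi_gt0.
by move=> x; rewrite in_itv/= => x0pi; exact/powR_gt0/sin_gt0_pi.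
Qed.

End sin_powR.

Section power_weight.
Context {R : realType}.
Variable lam : R.
Hypothesis lam0 : 0 < lam.
Local Notation mu := (@lebesgue_measure R).
Implicit Types a b x y : R.

Let lam2 : 0 < 2 * lam. Proof. by rewrite mulr_gt0. Qed.

Lemma measurable_wmu (D : set R) : measurable_fun D (wmu lam).
Proof. by apply: measurable_funTS; exact: measurable_powR. Qed.

Lemma wmu_ge0 x : 0 <= wmu lam x.
Proof. exact: powR_ge0. Qed.

Lemma le_wmu x y : 0 <= x -> x <= y -> wmu lam x <= wmu lam y.
Proof.
move=> x0 xy; rewrite ge0_ler_powR ?nnegrE ?(ltW lam2)//.
exact: le_trans xy.
Qed.

Lemma integrable_wmu a b : 0 <= a -> mu.-integrable `]a, b[ (EFin \o wmu lam).
Proof.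
move=> a0; apply: (@integrable_itvoo_bounded _ _ _ _ (wmu lam b)).
  exact: measurable_wmu.
move=> x; rewrite in_itv/= => /andP[ax xb].
by rewrite ger0_norm ?wmu_ge0// le_wmu// ltW// (le_lt_trans a0).
Qed.

Lemma muB_itvoo a b : 0 <= a ->
  muB lam `]a, b[ = (\int[mu]_(x in `]a, b[) wmu lam x)%:E.
Proof.
move=> a0; rewrite /muB fineK//.
exact: integrable_fin_num (integrable_wmu _ a0).
Qed.

Lemma muB_itvoo_ge a b : 0 <= a -> a <= b ->
  ((wmu lam a * (b - a))%:E <= muB lam `]a, b[)%E.
Proof.
move=> a0 ab; have mu_ab : (mu `]a, b[ = (b - a)%:E)%E.
  rewrite lebesgue_measure_itv/= lte_fin -EFinB; case: ltgtP ab => // -> _.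
  by rewrite subrr.
rewrite EFinM -mu_ab -integral_cst//; apply: ge0_le_integral => //.
- by move=> x _; rewrite lee_fin wmu_ge0.
- by apply/measurable_EFinP; exact: measurable_wmu.
- move=> x /=; rewrite in_itv/= => /andP[ax _].
  by rewrite lee_fin le_wmu// ltW.
Qed.

(* Comparing with the right half of the interval, where x >= b / 2. *)
Lemma wmu_le_average a b : 0 <= a -> a < b ->
  wmu lam b * (b - a) <= 2 `^ (2 * lam + 1) * \int[mu]_(x in `]a, b[) wmu lam x.
Proof.
move=> a0 ab; pose m := (a + b) / 2.
have [am mb] : a <= m /\ m <= b by rewrite /m; split; lra.
have m0 : 0 <= m := le_trans a0 am.
have half : wmu lam m * (b - m) <= \int[mu]_(x in `]a, b[) wmu lam x.
  rewrite -lee_fin -muB_itvoo// (le_trans (muB_itvoo_ge m0 mb))//.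
  apply: ge0_subset_integral => //.
  - by apply/measurable_EFinP; exact: measurable_wmu.
  - by move=> x _; rewrite lee_fin wmu_ge0.
  - by apply: subset_itv; rewrite bnd_simp.
apply: le_trans (ler_wpM2l (powR_ge0 _ _) half).
have b2m : wmu lam b <= 2 `^ (2 * lam) * wmu lam m.
  by rewrite -powRM// le_wmu ?(le_trans a0 (ltW ab))// /m; lra.
rewrite powRD ?pnatr_eq0 ?implybT// powRr1//.
have -> : 2 `^ (2 * lam) * 2 * (wmu lam m * (b - m)) =
    2 `^ (2 * lam) * wmu lam m * (b - a) by rewrite /m; field.
by rewrite ler_wpM2r// subr_ge0 ltW.
Qed.

Lemma Rintegral_wmu_gt0 a b : 0 <= a -> a < b ->
  0 < \int[mu]_(x in `]a, b[) wmu lam x.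
Proof.
move=> a0 ab; have b0 := le_lt_trans a0 ab.
have : 0 < wmu lam b * (b - a) by rewrite mulr_gt0 ?powR_gt0 ?subr_gt0.
by move=> /lt_le_trans/(_ (wmu_le_average a0 ab)); rewrite pmulr_rgt0 ?powR_gt0.
Qed.

(* [ln s <= s] at [s = (b / x) `^ (2 * lam)]. *)
Lemma ln_dist_wmu_le b x : 0 < x -> x <= b ->
  `|ln x - ln b| * wmu lam x <= wmu lam b / (2 * lam).
Proof.
move=> x0 xb; have b0 := lt_le_trans x0 xb.
have bx0 : 0 < b / x by rewrite divr_gt0.
have -> : wmu lam b = (b / x) `^ (2 * lam) * wmu lam x.
  by rewrite -powRM ?(ltW x0) ?(ltW bx0)// divfK// gt_eqF.
rewrite distrC ger0_norm ?subr_ge0 ?ler_ln ?posrE//.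
rewrite mulrAC ler_wpM2r ?wmu_ge0// ler_pdivlMr// mulrC.
by rewrite -ln_div ?posrE// -ln_powR ltW// ln_sublinear// powR_gt0.
Qed.

Lemma integrable_ln_dist_wmu a b : 0 <= a ->
  mu.-integrable `]a, b[ (EFin \o (fun x => (ln x - ln b) * wmu lam x)).
Proof.
move=> a0; apply: (@integrable_itvoo_bounded _ _ _ _ (wmu lam b / (2 * lam))).
  apply: measurable_funM; last exact: measurable_wmu.
  by apply: measurable_funB => //; apply: measurable_funTS; exact: measurable_ln.
move=> x; rewrite in_itv/= => /andP[ax xb].
rewrite normrM (ger0_norm (wmu_ge0 x)) ln_dist_wmu_le ?(ltW xb)//.
exact: le_lt_trans ax.
Qed.

Lemma integrable_ln_wmu a b : 0 <= a ->
  mu.-integrable `]a, b[ (EFin \o (fun x => ln x * wmu lam x)).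
Proof.
move=> a0.
have int_lnb : mu.-integrable `]a, b[ (EFin \o (fun x => ln b * wmu lam x)).
  exact: (integrableZl _ _ (integrable_wmu b a0)).
apply: eq_integrable (integrableD _ (integrable_ln_dist_wmu b a0) int_lnb) => //.
by move=> x _ /=; rewrite -EFinD -mulrDl subrK.
Qed.

Lemma Rintegral_ln_dist_wmu_le a b : 0 <= a -> a < b ->
  \int[mu]_(x in `]a, b[) (`|ln x - ln b| * wmu lam x) <=
  wmu lam b / (2 * lam) * (b - a).
Proof.
move=> a0 ab; have mu_ab : fine (mu `]a, b[) = b - a.
  by rewrite lebesgue_measure_itv/= lte_fin ab -EFinB.
rewrite -mu_ab -Rintegral_cst//; apply: le_Rintegral => //.
- apply: eq_integrable (integrable_norm (integrable_ln_dist_wmu b a0)) => // x _.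
  by rewrite /= normrM (ger0_norm (wmu_ge0 x)).
- exact: (@integrable_itvoo_bounded _ _ _ _ `|wmu lam b / (2 * lam)|).
- move=> x /=; rewrite in_itv/= => /andP[ax xb].
  by rewrite ln_dist_wmu_le ?(le_lt_trans a0 ax) ?(ltW xb).
Qed.

Lemma BMO_ln : BMO lam (@ln R).
Proof.
split; first by move=> a b a0 _; exact: integrable_ln_wmu.
exists (2 * (2 `^ (2 * lam + 1) / (2 * lam))) => a b a0 ab.
have w_gt0 := Rintegral_wmu_gt0 a0 ab.
rewrite ler_pdivrMr//.
have osc := @weighted_mean_oscillation_le _ _ _ mu `]a, b[ _ _
  (measurable_itv _) wmu_ge0 (integrable_wmu b a0) (integrable_ln_wmu b a0)
  w_gt0 (ln b).
apply: (le_trans osc).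
rewrite -mulrA ler_pM2l// (le_trans (Rintegral_ln_dist_wmu_le a0 ab))//.
rewrite mulrAC [leRHS]mulrAC ler_pM2r ?invr_gt0//.
exact: wmu_le_average.
Qed.

End power_weight.

Section riesz_kernel.
Context {R : realType}.
Variable lam : R.
Hypothesis lam0 : 0 < lam.
Local Notation mu := (@lebesgue_measure R).
Implicit Types x y th : R.

Let lam2 : 0 < 2 * lam. Proof. by rewrite mulr_gt0. Qed.

Definition Rkernel_integrand x y th : R :=
  (x - y * cos th) * (sin th) `^ (2 * lam - 1) /
  (x ^+ 2 + y ^+ 2 - 2 * x * y * cos th) `^ (lam + 1).

Definition Rkernel_const : R :=
  2 * lam / pi * \int[mu]_(th in `[0, pi]) (sin th `^ (2 * lam - 1)).

(* Bounds for [- Rkernel lam x y], obtained by replacing [cos th] with [1] or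
   [-1] in the integrand. *)
Definition Rkernel_minorant x y : R :=
  Rkernel_const * ((x - y) / ((x + y) ^+ 2) `^ (lam + 1)).

Definition Rkernel_majorant x y : R :=
  Rkernel_const * ((x + y) / ((x - y) ^+ 2) `^ (lam + 1)).

Lemma Rkernel_const_gt0 : 0 < Rkernel_const.
Proof. by rewrite mulr_gt0 ?Rintegral_sin_powR_gt0// divr_gt0// pi_gt0. Qed.

Lemma measurable_Rkernel_integrand x :
  measurable_fun setT (fun z : R * R => Rkernel_integrand x z.1 z.2).
Proof.
have mcos : measurable_fun setT (fun z : R * R => cos z.2).
  apply: measurableT_comp => //.
  by apply: continuous_measurable_fun; exact: continuous_cos.
rewrite /Rkernel_integrand; under eq_fun do rewrite -powRN.
apply: measurable_funM; first apply: measurable_funM.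
- by apply: measurable_funB => //; exact: measurable_funM.
- exact: (measurableT_comp (measurable_sin_powR _) measurable_snd).
- apply: (measurableT_comp (measurable_powR _)).
  apply: measurable_funB; last by do 2 apply: measurable_funM => //.
  by apply: measurable_funD => //; exact: measurable_funX.
Qed.

Lemma measurable_Rkernel x : measurable_fun setT (Rkernel lam x).
Proof.
apply: measurable_funM => //.
exact: (@measurable_fun_parametric_Rintegral _ _ _ _ _ mu `[0, pi] _
  (measurable_itv _) (measurable_Rkernel_integrand x)).
Qed.

Lemma Rkernel_integrand_bounds x y th : 0 < y < x ->
  (x - y) / ((x + y) ^+ 2) `^ (lam + 1) * sin th `^ (2 * lam - 1)
    <= Rkernel_integrand x y th
    <= (x + y) / ((x - y) ^+ 2) `^ (lam + 1) * sin th `^ (2 * lam - 1).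
Proof.
move=> /andP[y0 yx]; have x0 := lt_trans y0 yx.
have cos1 := cos_le1 th; have cosN1 := cos_geN1 th.
have [y_cos_le y_cos_ge] : y * cos th <= y /\ - y <= y * cos th.
  by split; [rewrite ler_piMr// ltW|rewrite -mulrN1 ler_wpM2l// ltW].
have [xy_cos_le xy_cos_ge] :
    x * (y * cos th) <= x * y /\ - (x * y) <= x * (y * cos th).
  by rewrite -mulrN !ler_pM2l.
rewrite /Rkernel_integrand (mulrAC (x - y * cos th)).
set Q := x ^+ 2 + _ - _.
have [Q_ge Q_le] : (x - y) ^+ 2 <= Q /\ Q <= (x + y) ^+ 2.
  by rewrite /Q sqrrB sqrrD; split; lra.
have dist0 : 0 < (x - y) ^+ 2 by rewrite exprn_gt0// subr_gt0.
have lam1 : 0 <= lam + 1 by rewrite addr_ge0// ltW.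
apply/andP; split; rewrite ler_wpM2r ?powR_ge0// ler_div_powR//.
- by rewrite subr_ge0 (ltW yx) lerB.
- by rewrite (lt_le_trans dist0 Q_ge).
- by rewrite subr_ge0 (le_trans y_cos_le (ltW yx)) lerD2l lerNl.
- by rewrite dist0.
Qed.

Let integrable_scaled_sin_powR k :
  mu.-integrable `[0, pi] (EFin \o (fun th : R => k * sin th `^ (2 * lam - 1))).
Proof. exact: (integrableZl _ k (integrable_sin_powR lam2)). Qed.

Lemma integrable_Rkernel_integrand x y : 0 < y < x ->
  mu.-integrable `[0, pi] (EFin \o Rkernel_integrand x y).
Proof.
move=> yx; have /andP[y0 /ltW xy] := yx.
apply: le_integrable (integrable_scaled_sin_powR
    ((x + y) / ((x - y) ^+ 2) `^ (lam + 1))) => //.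
  apply/measurable_EFinP; apply: measurable_funTS.
  exact: (measurableT_comp (measurable_Rkernel_integrand x) (pair1_measurable y)).
move=> th _ /=; have /andP[lo hi] := Rkernel_integrand_bounds th yx.
have integrand_ge0 : 0 <= Rkernel_integrand x y th.
  by rewrite (le_trans _ lo)// mulr_ge0 ?powR_ge0// divr_ge0 ?powR_ge0// subr_ge0.
by rewrite lee_fin !ger0_norm// (le_trans integrand_ge0).
Qed.

Lemma Rkernel_bounds x y : 0 < y < x ->
  Rkernel_minorant x y <= - Rkernel lam x y <= Rkernel_majorant x y.
Proof.
move=> yx; have bounds th := Rkernel_integrand_bounds th yx.
have k0 : 0 < 2 * lam / pi by rewrite divr_gt0 ?pi_gt0.
have constM k : Rkernel_const * k =
    2 * lam / pi * \int[mu]_(th in `[0, pi]) (k * sin th `^ (2 * lam - 1)).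
  by rewrite RintegralZl ?integrable_sin_powR// mulrA mulrAC.
rewrite /Rkernel -/(Rkernel_integrand x y) mulNr opprK.
rewrite /Rkernel_minorant /Rkernel_majorant !constM !ler_pM2l//.
have int_integrand := integrable_Rkernel_integrand yx.
by apply/andP; split; apply: le_Rintegral => // th _; have /andP[] := bounds th.
Qed.

Lemma Rkernel_minorant_gt0 x y : 0 < y -> y < x -> 0 < Rkernel_minorant x y.
Proof.
move=> y0 yx; rewrite mulr_gt0 ?Rkernel_const_gt0// divr_gt0 ?subr_gt0//.
by rewrite powR_gt0// exprn_gt0// addr_gt0// (lt_trans y0).
Qed.

Lemma Rkernel_bounds_itv x y e : 0 < y < e -> e < x ->
  Rkernel_minorant x e <= - Rkernel lam x y <= Rkernel_majorant x e.
Proof.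
move=> /andP[y0 ye] ex; have yx := lt_trans ye ex; have x0 := lt_trans y0 yx.
have /Rkernel_bounds/andP[minor major] : 0 < y < x by rewrite y0.
have e0 := lt_trans y0 ye; have lam1 : 0 <= lam + 1 by rewrite addr_ge0// ltW.
rewrite (le_trans _ minor) ?(le_trans major)// ler_pM2l ?Rkernel_const_gt0//.
all: rewrite ler_div_powR// ?exprn_gt0 ?lerXn2r ?nnegrE; lra.
Qed.

End riesz_kernel.

Section commutator.
Context {R : realType}.
Variable lam : R.
Hypothesis lam0 : 0 < lam.
Local Notation mu := (@lebesgue_measure R).
Implicit Types (b f g : R -> R) (x y e t delta eps : R).

Lemma pvR_away g x delta (S : set R) : 0 < delta -> measurable S ->
  S `<=` [set y | 0 < y /\ delta <= `|x - y|] ->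
  (forall y, ~ S y -> g y = 0) ->
  mu.-integrable S (EFin \o (fun y => Rkernel lam x y * g y * wmu lam y)) ->
  pvR lam g x (\int[mu]_(y in S) (Rkernel lam x y * g y * wmu lam y)).
Proof.
move=> delta0 mS Saway g0 intg.
pose D eps := [set y | 0 < y /\ eps < `|x - y|].
have mD eps : measurable (D eps).
  rewrite (_ : D eps = `]0, +oo[ `\` `[x - eps, x + eps]).
    exact: measurableD.
  apply/seteqP; split=> y; rewrite /D /= !in_itv/= andbT -ler_distlC.
    by rewrite [eps < _]ltNge => -[y0 /negP ye].
  by move=> [y0 /negP]; rewrite -ltNge.
have SD eps : eps < delta -> S `<=` D eps.
  by move=> epsd y /Saway[y0 dxy]; split=> //; exact: lt_le_trans dxy.
have integrand0 y : ~ S y -> Rkernel lam x y * g y * wmu lam y = 0.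
  by move=> /g0->; rewrite mulr0 mul0r.
split; last apply: cvg_near_cst; near=> eps.
all: have epsD : S `<=` D eps by apply: SD; near: eps; exact: nbhs_right_lt.
  by apply: (@integrable_support_sub _ _ _ mu S (D eps)) => //; exact: mD.
exact: (@Rintegral_support_sub _ _ _ mu S (D eps)).
Unshelve. all: by end_near. Qed.

Lemma Rkernel_bounded_away x e : 0 < e -> e < x ->
  [bounded Rkernel lam x y | y in `]0, e[%classic].
Proof.
move=> e0 ex; exists (Rkernel_majorant lam x e); split; first exact: num_real.
move=> M boundM y /=; rewrite in_itv/= => /(Rkernel_bounds_itv lam0)/(_ ex).
move=> /andP[minor major]; rewrite -normrN ger0_norm.
  exact: le_trans major (ltW boundM).
by rewrite (le_trans _ minor)// ltW// Rkernel_minorant_gt0.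
Qed.

Lemma integrable_Rkernel_mul g x e : 0 < e -> e < x ->
  mu.-integrable `]0, e[ (EFin \o (fun y => g y * wmu lam y)) ->
  mu.-integrable `]0, e[ (EFin \o (fun y => Rkernel lam x y * g y * wmu lam y)).
Proof.
move=> e0 ex intg.
have mker : measurable_fun `]0, e[ (Rkernel lam x).
  by apply: measurable_funTS; exact: measurable_Rkernel.
have := @integrableMr _ _ _ mu `]0, e[ (measurable_itv _) _ _ mker
  (Rkernel_bounded_away e0 ex) intg.
by apply: eq_integrable => // y _ /=; rewrite -EFinM mulrA.
Qed.

Section separated_support.
Variables (b f : R -> R) (x e : R).
Hypotheses (e0 : 0 < e) (ex : e < x).
Hypothesis f0 : forall y, ~ `]0, e[%classic y -> f y = 0.
Hypothesis intf : mu.-integrable `]0, e[ (EFin \o (fun y => f y * wmu lam y)).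
Hypothesis intbf :
  mu.-integrable `]0, e[ (EFin \o (fun y => b y * f y * wmu lam y)).

Let intKf : mu.-integrable `]0, e[
  (EFin \o (fun y => Rkernel lam x y * f y * wmu lam y)).
Proof. exact: integrable_Rkernel_mul. Qed.

Let intKbf : mu.-integrable `]0, e[
  (EFin \o (fun y => Rkernel lam x y * (b y * f y) * wmu lam y)).
Proof. exact: (@integrable_Rkernel_mul (fun y => b y * f y)). Qed.

Let intbKf : mu.-integrable `]0, e[
  (EFin \o (fun y => b x * (Rkernel lam x y * f y * wmu lam y))).
Proof. exact: (integrableZl _ (b x) intKf). Qed.

Let comm_integrandE y :
  b x * (Rkernel lam x y * f y * wmu lam y) -
    Rkernel lam x y * (b y * f y) * wmu lam y =
  (b x - b y) * (Rkernel lam x y * f y * wmu lam y).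
Proof. ring. Qed.

Lemma integrable_comm_integrand : mu.-integrable `]0, e[
  (EFin \o (fun y => (b x - b y) * (Rkernel lam x y * f y * wmu lam y))).
Proof.
apply: eq_integrable (integrableB _ intbKf intKbf) => // y _ /=.
by rewrite -EFinB comm_integrandE.
Qed.

Lemma comm_gt_separated t :
  t < `|\int[mu]_(y in `]0, e[)
         ((b x - b y) * (Rkernel lam x y * f y * wmu lam y))| ->
  comm_gt lam b f t x.
Proof.
have away : `]0, e[ `<=` [set y | 0 < y /\ x - e <= `|x - y|].
  move=> y /=; rewrite in_itv/= => /andP[y0 ye]; split=> //.
  by rewrite (le_trans _ (ler_norm _))// lerB// ltW.
have xe0 : 0 < x - e by rewrite subr_gt0.
move=> tlt; eexists; eexists; split; last split.
- exact: (pvR_away xe0 (measurable_itv _) away f0 intKf).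
- apply: (pvR_away xe0 (measurable_itv _) away _ intKbf).
  by move=> y /f0->; rewrite mulr0.
rewrite -RintegralZl// -RintegralB//.
by under eq_Rintegral do rewrite comm_integrandE.
Qed.

End separated_support.

Local Notation indic e := (\1_(`]0, e[%classic : set R) : R -> R).

Let indic_off e y : ~ `]0, e[%classic y -> indic e y = 0.
Proof. by move=> ye; rewrite indicE memNset. Qed.

Let indic_on e y : y \in `]0, e[%classic -> indic e y = 1.
Proof. by move=> ye; rewrite indicE ye. Qed.

Lemma L1mu_indic e : L1mu lam (indic e).
Proof.
apply: (@integrable_support_sub _ _ _ mu `]0, e[) => //.
- by apply: subset_itv; rewrite bnd_simp.
- by move=> y /indic_off ->; rewrite mul0r.
- apply: eq_integrable (integrable_wmu lam0 e (lexx 0)) => // y /indic_on y1.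
  by rewrite /= y1 mul1r.
Qed.

Lemma L1norm_indic e :
  L1norm lam (indic e) = \int[mu]_(y in `]0, e[) wmu lam y.
Proof.
rewrite /L1norm (@Rintegral_support_sub _ _ _ mu `]0, e[)//.
- by apply: eq_Rintegral => y /indic_on ->; rewrite normr1 mul1r.
- by apply: subset_itv; rewrite bnd_simp.
- by move=> y /indic_off ->; rewrite normr0 mul0r.
Qed.

Let ln_kernel_indic_le x e y : 0 < e -> e < x -> `]0, e[%classic y ->
  (ln x - ln y) * (Rkernel lam x y * indic e y * wmu lam y) <=
  - (Rkernel_minorant lam x e * (ln x - ln e)) * wmu lam y.
Proof.
move=> e0 ex ey; have x0 := lt_trans e0 ex.
rewrite indic_on ?inE// mulr1 mulrA ler_wpM2r ?wmu_ge0//.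
move: ey; rewrite /= in_itv/= => ye; have /andP[y0 /ltW y_le_e] := ye.
have /andP[minor _] := Rkernel_bounds_itv lam0 ye ex.
rewrite lerNr -mulrN [leRHS]mulrC ler_pM ?lerB//.
- by rewrite ltW// Rkernel_minorant_gt0.
- by rewrite subr_ge0 ler_ln ?posrE// ltW.
- by rewrite ler_ln ?posrE.
Qed.

Lemma comm_gt_ln_indic x e t : 0 < e -> e < x ->
  t < Rkernel_minorant lam x e * (ln x - ln e) * L1norm lam (indic e) ->
  comm_gt lam (@ln R) (indic e) t x.
Proof.
move=> e0 ex t_lt.
have intw : mu.-integrable `]0, e[ (EFin \o wmu lam).
  exact: (integrable_wmu lam0 e (lexx 0)).
have intf : mu.-integrable `]0, e[ (EFin \o (fun y => indic e y * wmu lam y)).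
  by apply: eq_integrable intw => // y /indic_on ey; rewrite /= ey mul1r.
have intlnf : mu.-integrable `]0, e[
    (EFin \o (fun y => ln y * indic e y * wmu lam y)).
  apply: eq_integrable (integrable_ln_wmu lam0 e (lexx 0)) => // y /indic_on ey.
  by rewrite /= ey mulr1.
have int_comm := integrable_comm_integrand e0 ex intf intlnf.
apply: (comm_gt_separated e0 ex (@indic_off e) intf intlnf).
apply: (lt_le_trans t_lt).
rewrite L1norm_indic -normrN (le_trans _ (ler_norm _))// lerNr.
rewrite -mulNr -RintegralZl//; apply: le_Rintegral => //.
  exact: (integrableZl _ _ intw).
by move=> y; exact: ln_kernel_indic_le.
Qed.

Lemma comm_gt_ln_indic_itv12 : exists2 c, 0 < c &
  forall x e t, 1 < x < 2 -> 0 < e <= 2^-1 ->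
    t < c * - ln e * L1norm lam (indic e) -> comm_gt lam (@ln R) (indic e) t x.
Proof.
exists (Rkernel_const lam * (2^-1 / 9 `^ (lam + 1))).
  by rewrite mulr_gt0 ?Rkernel_const_gt0// divr_gt0// powR_gt0.
move=> x e t /andP[x1 x2] /andP[e0 e2] t_lt.
have ex : e < x by lra.
apply: comm_gt_ln_indic => //; apply: lt_le_trans t_lt _.
have norm0 : 0 <= L1norm lam (indic e).
  by rewrite L1norm_indic ltW// Rintegral_wmu_gt0.
have lne0 : 0 <= - ln e by rewrite oppr_ge0 ln_le0//; lra.
have lnx0 : 0 <= ln x by rewrite ln_ge0// ltW.
rewrite ler_wpM2r// ler_pM ?lerDr//.
  by rewrite mulr_ge0 ?ltW ?Rkernel_const_gt0// divr_ge0 ?powR_ge0.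
rewrite ler_pM2l ?Rkernel_const_gt0// ler_div_powR ?addr_ge0 ?(ltW lam0)//.
  by lra.
by rewrite exprn_gt0 ?addr_gt0 ?(lt_trans e0 ex)//; nra.
Qed.

Lemma comm_ln_unbounded M : exists f t,
  [/\ L1mu lam f, 0 < t, M * L1norm lam f < t &
      forall x, 1 < x < 2 -> comm_gt lam (@ln R) f t x].
Proof.
have [c c0 comm_gt_c] := comm_gt_ln_indic_itv12.
pose N := 1 + (`|M| + 1) / c; pose e := expR (- N).
have cN : `|M| + 1 < c * N.
  by rewrite mulrDr mulr1 mulrCA divff ?gt_eqF// mulr1 ltrDr.
have N1 : 1 <= N by rewrite lerDl divr_ge0 ?addr_ge0// ltW.
have e0 : 0 < e by exact: expR_gt0.
have e2 : e <= 2^-1.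
  rewrite /e expRN lef_pV2 ?posrE ?expR_gt0//.
  by rewrite (le_trans _ (expR_ge1Dx N))// lerD2l.
have norm0 : 0 < L1norm lam (indic e) by rewrite L1norm_indic Rintegral_wmu_gt0.
have M1 : 0 < `|M| + 1 by rewrite ltr_wpDl.
exists (indic e), ((`|M| + 1) * L1norm lam (indic e)); split.
- exact: L1mu_indic.
- by rewrite mulr_gt0.
- by rewrite ltr_pM2r// (le_lt_trans (ler_norm M))// ltrDl.
- move=> x x12; apply: comm_gt_c => //; first by rewrite e0.
  by rewrite /e expRK opprK ltr_pM2r.
Qed.

End commutator.

Theorem theorem1p13 (R : realType) (lam : R) (hlam : 0 < lam) :
  exists b0 : R -> R, BMO lam b0 /\
    ~ (exists C : R, forall (f : R -> R) (t : R), L1mu lam f -> 0 < t ->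
         forall A : set R, measurable A ->
           A `<=` [set x | 0 < x /\ comm_gt lam b0 f t x] ->
           (muB lam A <= (C / t * L1norm lam f)%:E)%E).
Proof.
exists (@ln R); split; first exact: BMO_ln.
move=> [C weak11].
have [f [t [L1f t0 norm_lt comm_gt_t]]] := comm_ln_unbounded hlam C.
have level_set : `]1, 2[ `<=` [set x | 0 < x /\ comm_gt lam (@ln R) f t x].
  move=> x /=; rewrite in_itv/= => x12; split; last exact: comm_gt_t.
  by case/andP: x12 => /(lt_trans ltr01).
have := weak11 f t L1f t0 _ (measurable_itv _) level_set.
apply/negP; rewrite -ltNge.
apply: lt_le_trans (muB_itvoo_ge hlam ler01 _); last by lra.
by rewrite lte_fin /wmu powR1 mul1r mulrAC ltr_pdivrMr//; lra.
Qed.
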